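(* Let $R=R_1\times R_2\times R_3$ be a decomposable ring and $M=M_1\times M_2\times M_3$ be an $R$-module where $M_i$ is an $R_i$-module for $i=1,2,3$. Let $\psi_i:S(M_i)\to S(M_i)\cup\{\emptyset\}$ be functions such that $\psi_i(M_i)\neq M_i$ for $i=1,2,3$, and let $\phi=\psi_1\times\psi_2\times\psi_3$. If $N$ is a $\phi$-classical prime submodule of $M$, then either $N=\phi(N)$ or $N$ is a classical prime submodule of $M$.
   Context: All rings are commutative with nonzero identity and all modules are unitary; decomposable means that $R$ is the direct product of the (nonzero) rings $R_1,R_2,R_3$, and $R$ acts on $M$ componentwise. For a module $M$, $S(M)$ is the set of all submodules of $M$. Standing convention: every function $\phi:S(M)\to S(M)\cup\{\emptyset\}$ considered (including each $\psi_i$) sends each submodule $N$ to a subset $\phi(N)\subseteq N$. Every submodule of $M$ has the form $N_1\times N_2\times N_3$ with $N_i$ a submodule of $M_i$, and $\phi=\psi_1\times\psi_2\times\psi_3$ means $\phi(N_1\times N_2\times N_3)=\psi_1(N_1)\times\psi_2(N_2)\times\psi_3(N_3)$, which is $\emptyset$ if one factor is $\emptyset$. A proper submodule $N$ of $M$ is $\phi$-classical prime if whenever $a,b\in R$ and $m\in M$ with $abm\in N\setminus\phi(N)$, then $am\in N$ or $bm\in N$; it is classical prime if whenever $a,b\in R$ and $m\in M$ with $abm\in N$, then $am\in N$ or $bm\in N$. *)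

(* Defs.v *)
From HB Require Import structures.
From mathcomp Require Import all_boot all_algebra.
From mathcomp Require Import boolp classical_sets.

Set Implicit Arguments.
Unset Strict Implicit.
Unset Printing Implicit Defensive.

Import GRing.Theory.
Local Open Scope ring_scope.
Local Open Scope classical_set_scope.

(* M1 * M2 * M3 as a module over R1 * R2 * R3.  This is an alias because the
   library's module structure on a product type has a single ring of scalars
   acting diagonally. *)
Definition prod3 (R1 R2 R3 : pzRingType)
  (M1 : lmodType R1) (M2 : lmodType R2) (M3 : lmodType R3) : Type :=
  (M1 * M2 * M3)%type.

Section Prod3.
Variables (R1 R2 R3 : pzRingType).
Variables (M1 : lmodType R1) (M2 : lmodType R2) (M3 : lmodType R3).
Local Notation R := (R1 * R2 * R3)%type.
Local Notation M := (prod3 M1 M2 M3).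

HB.instance Definition _ := GRing.Zmodule.copy M (M1 * M2 * M3)%type.

Definition scale3 (r : R) (m : M) : M :=
  (r.1.1 *: m.1.1, r.1.2 *: m.1.2, r.2 *: m.2).

Fact scale3A a b m : scale3 a (scale3 b m) = scale3 (a * b) m.
Proof. by rewrite /scale3 /= !scalerA. Qed.

Fact scale31 : left_id 1 scale3.
Proof. by case=> [[x y] z]; rewrite /scale3 /= !scale1r. Qed.

Fact scale3Dr : right_distributive scale3 +%R.
Proof. by move=> a u v; rewrite /scale3 /= !scalerDr. Qed.

Fact scale3Dl v : {morph scale3^~ v : a b / a + b}.
Proof. by move=> a b; rewrite /scale3 /= !scalerDl. Qed.

HB.instance Definition _ :=
  GRing.Zmodule_isLmodule.Build R M scale3A scale31 scale3Dr scale3Dl.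
End Prod3.

Record submodule (R : pzRingType) (M : lmodType R) := Submodule {
  smset :> set M;
  smP : submod_closed [in smset]
}.

Fact full_closed (R : pzRingType) (M : lmodType R) :
  submod_closed [in [set: M]].
Proof. by split=> [|a u v _ _]; exact: in_setT. Qed.

Definition full (R : pzRingType) (M : lmodType R) : submodule M :=
  Submodule (@full_closed R M).

Section SubProd3.
Variables (R1 R2 R3 : pzRingType).
Variables (M1 : lmodType R1) (M2 : lmodType R2) (M3 : lmodType R3).
Variables (N1 : submodule M1) (N2 : submodule M2) (N3 : submodule M3).

Fact subprod3_closed :
  submod_closed [in (N1 `*` N2 `*` N3 : set (prod3 M1 M2 M3))].
Proof.
case: N1 N2 N3 => [A1 [z1 c1]] [A2 [z2 c2]] [A3 [z3 c3]] /=.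
split; first by apply/mem_set; split; [split|]; exact: set_mem.
move=> a u v /set_mem [[/= u1 u2] u3] /set_mem [[/= v1 v2] v3].
apply/mem_set; split; [split|]; apply: set_mem => /=.
- by apply: c1; apply: mem_set.
- by apply: c2; apply: mem_set.
- by apply: c3; apply: mem_set.
Qed.

Definition subprod3 : submodule (prod3 M1 M2 M3) := Submodule subprod3_closed.
End SubProd3.

Section ClassicalPrime.
Variables (R : comNzRingType) (M : lmodType R).

(* Functions S(M) -> S(M) U {set0} with phi N contained in N; the codomain
   condition is stated on the underlying sets. *)
Definition submodule_fun (phi : submodule M -> set M) : Prop :=
  forall N, (phi N = set0 \/ submod_closed [in phi N]) /\ phi N `<=` N.

Definition proper_submodule (N : submodule M) : Prop := N <> [set: M] :> set M.

Definition classical_prime (N : submodule M) : Prop :=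
  proper_submodule N /\
  forall (a b : R) (m : M),
    smset N ((a * b) *: m) -> smset N (a *: m) \/ smset N (b *: m).

Definition phi_classical_prime (phi : submodule M -> set M)
    (N : submodule M) : Prop :=
  proper_submodule N /\
  forall (a b : R) (m : M),
    (N `\` phi N) ((a * b) *: m) -> smset N (a *: m) \/ smset N (b *: m).
End ClassicalPrime.

(* phi = psi1 x psi2 x psi3.  The equation determines phi because every
   submodule of M1 x M2 x M3 is of the form subprod3 N1 N2 N3; the right-hand
   side is set0 as soon as one factor is. *)
Definition is_prod_fun (R1 R2 R3 : pzRingType)
    (M1 : lmodType R1) (M2 : lmodType R2) (M3 : lmodType R3)
    (psi1 : submodule M1 -> set M1) (psi2 : submodule M2 -> set M2)
    (psi3 : submodule M3 -> set M3)
    (phi : submodule (prod3 M1 M2 M3) -> set (prod3 M1 M2 M3)) : Prop :=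
  forall N1 N2 N3,
    phi (subprod3 N1 N2 N3) = psi1 N1 `*` psi2 N2 `*` psi3 N3.

(* Main.v *)
(* Write N = N1 x N2 x N3 and assume N <> phi N, so that some n in N_i lies
   outside psi_i N_i.  If both other components were proper, with m_j and m_k
   outside N_j and N_k, then the element with entries n, m_j, m_k and the
   idempotents (1,0,1), (1,1,0) would contradict phi-classical primeness; so
   one of them is full.  A full component is again not contained in its psi_j,
   so the same argument yields a second full component.  When two components
   are full, replacing one coordinate by an element outside its psi keeps every
   product outside phi N, and the condition outside phi N becomes the classical
   one. *)
Require Import Defs.
From HB Require Import structures.
From mathcomp Require Import all_boot all_algebra.
From mathcomp Require Import boolp classical_sets.

Set Implicit Arguments.
Unset Strict Implicit.
Unset Printing Implicit Defensive.

Import GRing.Theory.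
Local Open Scope ring_scope.
Local Open Scope classical_set_scope.

Section Submodules.
Variables (R : pzRingType) (M : lmodType R).
Implicit Types N : submodule M.

Lemma submodule0 N : smset N 0.
Proof. by case: (smP N) => /set_mem. Qed.

Lemma submoduleZD N a u v :
  smset N u -> smset N v -> smset N (a *: u + v).
Proof.
case: (smP N) => _ closedN Nu Nv; apply: set_mem.
by apply: closedN; exact: mem_set.
Qed.

Lemma submoduleZ N a u : smset N u -> smset N (a *: u).
Proof.
by move=> Nu; rewrite -[_ *: _]addr0; apply: submoduleZD Nu (submodule0 N).
Qed.

Lemma submoduleD N u v : smset N u -> smset N v -> smset N (u + v).
Proof. by move=> Nu Nv; rewrite -[u]scale1r; exact: submoduleZD. Qed.

Lemma submodule_ext N N' : N = N' :> set M -> N = N'.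
Proof.
case: N N' => [A cA] [B cB] /= eqAB; case: _ / eqAB cB => cB.
by congr Submodule; exact: Prop_irrelevance.
Qed.
End Submodules.

Section Preimage.
Variables (R S : pzRingType) (M : lmodType R) (M' : lmodType S).
Variables (g : R -> S) (f : M -> M') (N : submodule M').
Hypothesis f0 : f 0 = 0.
Hypothesis fZD : forall a u v, f (a *: u + v) = g a *: f u + f v.

(** [g] is a bare map, not a ring morphism: it will be the embedding of a factor ring into the
    product, which does not preserve 1. *)
Fact presubmodule_closed : submod_closed [in f @^-1` N].
Proof.
split=> [|a u v /set_mem Nu /set_mem Nv]; apply: mem_set => /=.
  by rewrite f0; exact: submodule0.
by rewrite fZD; exact: submoduleZD.
Qed.

Definition presubmodule : submodule M := Submodule presubmodule_closed.
End Preimage.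

(** Each component is the preimage of [N] under a coordinate embedding. Scaling by the idempotents
    [e1 1], [e2 1], [e3 1] isolates the coordinates of an element without leaving [N], and their sum
    restores it. *)
Lemma submodule_prod3E (R1 R2 R3 : pzRingType)
  (M1 : lmodType R1) (M2 : lmodType R2) (M3 : lmodType R3)
  (N : submodule (prod3 M1 M2 M3)) :
  exists N1 N2 N3, N = subprod3 N1 N2 N3.
Proof.
pose f1 (x : M1) : prod3 M1 M2 M3 := (x, 0, 0).
pose f2 (x : M2) : prod3 M1 M2 M3 := (0, x, 0).
pose f3 (x : M3) : prod3 M1 M2 M3 := (0, 0, x).
pose e1 (a : R1) : R1 * R2 * R3 := (a, 0, 0).
pose e2 (a : R2) : R1 * R2 * R3 := (0, a, 0).
pose e3 (a : R3) : R1 * R2 * R3 := (0, 0, a).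
have f1ZD a u v : f1 (a *: u + v) = e1 a *: f1 u + f1 v.
  by congr (_, _, _) => /=; rewrite scaler0 addr0.
have f2ZD a u v : f2 (a *: u + v) = e2 a *: f2 u + f2 v.
  by congr (_, _, _) => /=; rewrite scaler0 addr0.
have f3ZD a u v : f3 (a *: u + v) = e3 a *: f3 u + f3 v.
  by congr (_, _, _) => /=; rewrite scaler0 addr0.
exists (presubmodule N (erefl : f1 0 = 0) f1ZD).
exists (presubmodule N (erefl : f2 0 = 0) f2ZD).
exists (presubmodule N (erefl : f3 0 = 0) f3ZD).
apply: submodule_ext; apply/seteqP; split=> -[[x y] z] /=.
  move=> Nxyz; split; [split|]; rewrite /preimage /=.
  - suff -> : f1 x = e1 1 *: ((x, y, z) : prod3 M1 M2 M3).
      exact: submoduleZ.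
    by congr (_, _, _) => /=; rewrite ?scale1r ?scale0r.
  - suff -> : f2 y = e2 1 *: ((x, y, z) : prod3 M1 M2 M3).
      exact: submoduleZ.
    by congr (_, _, _) => /=; rewrite ?scale1r ?scale0r.
  - suff -> : f3 z = e3 1 *: ((x, y, z) : prod3 M1 M2 M3).
      exact: submoduleZ.
    by congr (_, _, _) => /=; rewrite ?scale1r ?scale0r.
move=> [[/= Nx Ny] Nz].
suff -> : ((x, y, z) : prod3 M1 M2 M3) = f1 x + f2 y + f3 z.
  by apply: submoduleD => //; exact: submoduleD.
by congr (_, _, _) => /=; rewrite ?addr0 ?add0r.
Qed.

(* The phi-classical prime condition on N1 x N2 x N3 with phi of it equal to
   P1 x P2 x P3, spelled out by components so that cyclic permutations of the
   three factors can be exploited. *)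
Definition prime3 (R1 R2 R3 : pzRingType)
    (M1 : lmodType R1) (M2 : lmodType R2) (M3 : lmodType R3)
    (N1 P1 : set M1) (N2 P2 : set M2) (N3 P3 : set M3) : Prop :=
  forall a1 b1 m1 a2 b2 m2 a3 b3 m3,
    N1 ((a1 * b1) *: m1) -> N2 ((a2 * b2) *: m2) -> N3 ((a3 * b3) *: m3) ->
    ~ [/\ P1 ((a1 * b1) *: m1), P2 ((a2 * b2) *: m2) &
          P3 ((a3 * b3) *: m3)] ->
    [/\ N1 (a1 *: m1), N2 (a2 *: m2) & N3 (a3 *: m3)] \/
    [/\ N1 (b1 *: m1), N2 (b2 *: m2) & N3 (b3 *: m3)].

Lemma prime3_rot (R1 R2 R3 : pzRingType)
    (M1 : lmodType R1) (M2 : lmodType R2) (M3 : lmodType R3)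
    (N1 P1 : set M1) (N2 P2 : set M2) (N3 P3 : set M3) :
  prime3 N1 P1 N2 P2 N3 P3 -> prime3 N2 P2 N3 P3 N1 P1.
Proof.
move=> pr a2 b2 m2 a3 b3 m3 a1 b1 m1 h2 h3 h1 nP.
case: (pr a1 b1 m1 a2 b2 m2 a3 b3 m3 h1 h2 h3) => [[p1 p2 p3]|[]|[]].
- by apply: nP.
- by left.
- by right.
Qed.

Section Prime3.
Variables (R1 R2 R3 : pzRingType).
Variables (M1 : lmodType R1) (M2 : lmodType R2) (M3 : lmodType R3).
Variables (N1 : submodule M1) (N2 : submodule M2) (N3 : submodule M3).
Variables (P1 : set M1) (P2 : set M2) (P3 : set M3).
Hypothesis prN : prime3 N1 P1 N2 P2 N3 P3.

Lemma prime3_full : ~ N1 `<=` P1 ->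
  N2 = [set: M2] :> set M2 \/ N3 = [set: M3] :> set M3.
Proof.
move=> /existsNP[n /not_implyP[Nn nPn]].
apply: contrapT => /not_orP[].
move=> /eqP/setTPn[m2 nN2] /eqP/setTPn[m3 nN3].
(* The product is [(n, 0, 0)], excluded from P1 x P2 x P3 by [n]. The first factor preserves [m3]
   and the second preserves [m2], so neither multiple lies in N. *)
case: (prN (a1 := 1) (b1 := 1) (m1 := n) (a2 := 0) (b2 := 1) (m2 := m2)
  (a3 := 1) (b3 := 0) (m3 := m3)).
- by rewrite mulr1 scale1r.
- by rewrite mul0r scale0r; exact: submodule0.
- by rewrite mulr0 scale0r; exact: submodule0.
- by rewrite mulr1 scale1r => -[].
- by rewrite !scale1r => -[].
- by rewrite !scale1r => -[].
Qed.

(** With [set0] for each [P] the exclusion clause is vacuous, so the conclusion is the classical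
    condition. Only the first coordinate matters, which leaves the second free to be replaced by [n]
    with scalars 1. *)
Lemma prime3_classical : N2 = [set: M2] :> set M2 ->
  N3 = [set: M3] :> set M3 -> ~ N2 `<=` P2 ->
  prime3 N1 set0 N2 set0 N3 set0.
Proof.
move=> N2T N3T /existsNP[n /not_implyP[Nn nPn]].
move=> a1 b1 m1 a2 b2 m2 a3 b3 m3 h1 h2 h3 _.
case: (prN (a1 := a1) (b1 := b1) (m1 := m1) (a2 := 1) (b2 := 1) (m2 := n)
  (a3 := a3) (b3 := b3) (m3 := m3)) => //.
- by rewrite mulr1 scale1r.
- by rewrite mulr1 scale1r => -[].
- by case=> ? _ _; left; rewrite N2T N3T.
- by case=> ? _ _; right; rewrite N2T N3T.
Qed.
End Prime3.

Section Prime3Classical.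
Variables (R1 R2 R3 : pzRingType).
Variables (M1 : lmodType R1) (M2 : lmodType R2) (M3 : lmodType R3).
Variables (N1 : submodule M1) (N2 : submodule M2) (N3 : submodule M3).
Variables (P1 : set M1) (P2 : set M2) (P3 : set M3).
Hypothesis prN : prime3 N1 P1 N2 P2 N3 P3.
Hypothesis fullP1 : N1 = [set: M1] :> set M1 -> ~ N1 `<=` P1.
Hypothesis fullP2 : N2 = [set: M2] :> set M2 -> ~ N2 `<=` P2.
Hypothesis fullP3 : N3 = [set: M3] :> set M3 -> ~ N3 `<=` P3.

Lemma prime3_nsub_classical :
  ~ N1 `<=` P1 -> prime3 N1 set0 N2 set0 N3 set0.
Proof.
have prN2 := prime3_rot prN; have prN3 := prime3_rot prN2.
have cl12 : N1 = [set: M1] :> set M1 -> N2 = [set: M2] :> set M2 ->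
    prime3 N1 set0 N2 set0 N3 set0.
  by move=> F1 F2; apply: prime3_rot; exact: prime3_classical prN3 F1 F2 (fullP1 F1).
have cl31 : N3 = [set: M3] :> set M3 -> N1 = [set: M1] :> set M1 ->
    prime3 N1 set0 N2 set0 N3 set0.
  move=> F3 F1; do 2 apply: prime3_rot.
  exact: prime3_classical prN2 F3 F1 (fullP3 F3).
(* The full component found first escapes its [P] by [fullP2] or [fullP3], so [prime3_full] applies
   again with that component rotated to the front. *)
move=> /(prime3_full prN)[F2|F3].
  case: (prime3_full prN2 (fullP2 F2)) => [F3|F1]; last exact: cl12.
  exact: prime3_classical prN F2 F3 (fullP2 F2).
case: (prime3_full prN3 (fullP3 F3)) => [F1|F2]; first exact: cl31.
exact: prime3_classical prN F2 F3 (fullP2 F2).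
Qed.
End Prime3Classical.

Lemma full_not_sub (R : pzRingType) (M : lmodType R)
    (psi : submodule M -> set M) (N : submodule M) :
  psi (full M) <> full M -> N = [set: M] :> set M -> ~ N `<=` psi N.
Proof.
(* [psi] acts on records, so equality of carriers must first become equality of submodules. *)
move=> psiT /(@submodule_ext _ _ N (full M)) -> sub.
by apply: psiT; apply/seteqP; split.
Qed.

Theorem theorem2p42 (R1 R2 R3 : comNzRingType)
  (M1 : lmodType R1) (M2 : lmodType R2) (M3 : lmodType R3)
  (psi1 : submodule M1 -> set M1)
  (psi2 : submodule M2 -> set M2)
  (psi3 : submodule M3 -> set M3)
  (phi : submodule (prod3 M1 M2 M3) -> set (prod3 M1 M2 M3))
  (N : submodule (prod3 M1 M2 M3)) :
  submodule_fun psi1 -> submodule_fun psi2 -> submodule_fun psi3 ->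
  psi1 (full M1) <> full M1 ->
  psi2 (full M2) <> full M2 ->
  psi3 (full M3) <> full M3 ->
  is_prod_fun psi1 psi2 psi3 phi ->
  phi_classical_prime phi N ->
  N = phi N :> set _ \/ classical_prime N.
Proof.
move=> psi1P psi2P psi3P psi1T psi2T psi3T phiE.
have [N1 [N2 [N3 ->]]] := submodule_prod3E N.
rewrite /phi_classical_prime phiE => -[prop primeN].
have F1 := full_not_sub (N := N1) psi1T.
have F2 := full_not_sub (N := N2) psi2T.
have F3 := full_not_sub (N := N3) psi3T.
have prN : prime3 N1 (psi1 N1) N2 (psi2 N2) N3 (psi3 N3).
  move=> a1 b1 m1 a2 b2 m2 a3 b3 m3 h1 h2 h3 nP.
  case: (primeN (a1, a2, a3) (b1, b2, b3) (m1, m2, m3)).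
  - by split=> // -[[p1 p2] p3]; apply: nP.
  - by move=> [[? ?] ?]; left.
  - by move=> [[? ?] ?]; right.
have classicalN : prime3 N1 set0 N2 set0 N3 set0 ->
    classical_prime (subprod3 N1 N2 N3).
  move=> cl; split=> // -[[a1 a2] a3] [[b1 b2] b3] [[m1 m2] m3] [[h1 h2] h3].
  by case: (cl _ _ _ _ _ _ _ _ _ h1 h2 h3) => [[]|[? ? ?]|[? ? ?]];
    [|left|right].
have prN2 := prime3_rot prN; have prN3 := prime3_rot prN2.
(* A component escaping its [psi] is rotated to the front and gives classical primeness; if none
   escapes, N is contained in its image under [phi]. *)
have [s1|n1] := pselect (N1 `<=` psi1 N1); last first.
  by right; apply: classicalN; exact: prime3_nsub_classical prN F1 F2 F3 n1.
have [s2|n2] := pselect (N2 `<=` psi2 N2); last first.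
  right; apply: classicalN; do 2 apply: prime3_rot.
  exact: prime3_nsub_classical prN2 F2 F3 F1 n2.
have [s3|n3] := pselect (N3 `<=` psi3 N3); last first.
  right; apply: classicalN; apply: prime3_rot.
  exact: prime3_nsub_classical prN3 F3 F1 F2 n3.
left; apply/seteqP; split=> -[[x y] z] [[/= hx hy] hz].
  by split; [split; [exact: s1|exact: s2]|exact: s3].
by split; [split; [apply: (psi1P N1).2|apply: (psi2P N2).2]|apply: (psi3P N3).2].
Qed.
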